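(* Let $x_k\in\mathbb{R}^n$, let $\sigma\in(0,1)$, and let $D_k$, $g_k$, $\omega_k$, $p_k$, $I_k^-$ be as in the context. For $\alpha>0$ the quantity $$\sigma\,\alpha\,(\bar g_k+\bar\omega_k)^T\bar p_k$$ is nonnegative, and it is positive for all $\alpha>0$ if and only if $x_k$ does not satisfy the first-order conditions $$\nabla_i f(x_k)=-\gamma\ \text{ if } x_k^i>0,\qquad \nabla_i f(x_k)\in[-\gamma,\gamma]\ \text{ if } x_k^i=0,\qquad \nabla_i f(x_k)=\gamma\ \text{ if } x_k^i<0\qquad(i=1,\dots,n).$$
   Context: Problem: minimize $\psi(x)=f(x)+\gamma\|x\|_1$ over $x\in\mathbb{R}^n$, where $\gamma>0$ and $f:\mathbb{R}^n\to\mathbb{R}$ is Lipschitz continuously differentiable (i.e. $\nabla f$ is Lipschitz) and bounded below. Superscript $i$ denotes the $i$-th component and $\nabla_i f$ the $i$-th component of $\nabla f$. Given $x_k\in\mathbb{R}^n$, let $g_k=\nabla f(x_k)$. Define the vector $\omega_k\in\mathbb{R}^n$ by: $\omega_k^i=\gamma$ if $x_k^i>0$, or $x_k^i=0$ and $g_k^i\le-\gamma$; $\omega_k^i=-\gamma$ if $x_k^i<0$, or $x_k^i=0$ and $g_k^i\ge\gamma$; $\omega_k^i=0$ if $x_k^i=0$ and $|g_k^i|<\gamma$. Let $I_k^+=\{i: x_k^i=0,\ |g_k^i|<\gamma\}$ and $I_k^-=\{1,\dots,n\}\setminus I_k^+$. $D_k\in\mathbb{R}^{n\times n}$ is a symmetric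 positive definite matrix that is diagonal with respect to $I_k^+$, i.e. $D_k[i,j]=0$ for all $i\in I_k^+$ and $j\neq i$. Let $p_k=D_k(g_k+\omega_k)$. $\bar g_k,\bar p_k,\bar\omega_k$ denote the subvectors of $g_k,p_k,\omega_k$ indexed by $I_k^-$ (an inner product over an empty index set is $0$). *)

(* Defs.v *)
From mathcomp Require Import all_boot all_order all_algebra.
From mathcomp Require Import all_classical all_reals all_analysis.

Set Implicit Arguments.
Unset Strict Implicit.
Unset Printing Implicit Defensive.

Import Order.TTheory GRing.Theory Num.Theory.
Import numFieldNormedType.Exports.

Local Open Scope classical_set_scope.
Local Open Scope ring_scope.

Section L1Regularized.
Variables (R : realType) (n : nat).
Implicit Types (f : 'cV[R]_n -> R) (gamma : R) (x g : 'cV[R]_n).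
Implicit Types (D : 'M[R]_n) (A : {set 'I_n}).

Definition gradient f x : 'cV[R]_n := \col_i 'D_(delta_mx i 0) f x.

(* The norm of 'cV[R]_n in the library is the sup norm; since the Lipschitz
   constant is existentially quantified, the choice of norm is immaterial. *)
Definition lipschitz_C1 f : Prop :=
  (forall x, differentiable f x) /\ (exists L : R, L.-lipschitz (gradient f)).

(* The three cases are exclusive, hence the order of the tests irrelevant, as
   soon as gamma > 0. *)
Definition omega gamma x g : 'cV[R]_n :=
  \col_i
    if (0 < x i 0) || ((x i 0 == 0) && (g i 0 <= - gamma)) then gamma
    else if (x i 0 < 0) || ((x i 0 == 0) && (gamma <= g i 0)) then - gamma
    else 0.

Definition Iplus gamma x g : {set 'I_n} :=
  [set i | (x i 0 == 0) && (`|g i 0| < gamma)].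

Definition Iminus gamma x g : {set 'I_n} := ~: Iplus gamma x g.

Definition sym_posdef D : Prop :=
  D^T = D /\ forall v : 'cV[R]_n, v != 0 -> 0 < (v^T *m D *m v) 0 0.

Definition diag_wrt A D : Prop :=
  forall i j : 'I_n, i \in A -> j != i -> D i j = 0.

Definition subvec A (v : 'cV[R]_n) : 'cV[R]_#|A| := rowsub (@enum_val _ (mem A)) v.

Definition first_order_conditions f gamma x : Prop :=
  forall i : 'I_n,
    [/\ 0 < x i 0 -> gradient f x i 0 = - gamma,
        x i 0 = 0 -> - gamma <= gradient f x i 0 <= gamma
      & x i 0 < 0 -> gradient f x i 0 = gamma].

End L1Regularized.

(* Main.v *)
Require Import Defs.
From mathcomp Require Import all_boot all_order all_algebra.
From mathcomp Require Import all_classical all_reals all_analysis.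
From mathcomp Require Import lra.
Set Implicit Arguments.
Unset Strict Implicit.
Unset Printing Implicit Defensive.
Import Order.TTheory GRing.Theory Num.Theory.
Import numFieldNormedType.Exports.
Local Open Scope classical_set_scope.
Local Open Scope ring_scope.

(** Put [v = g + w].  On the indices of [Iminus] the vector [w] is the gradient
    there of the l1 term (or, at a zero coordinate with large partial
    derivative, the choice of its subgradient nearest to [- g]), so [v i = 0] is
    exactly the first-order condition at [i]; on [Iplus] that condition holds
    automatically ([first_order_conditionsE]).  Hence the conditions fail if and
    only if the vector [u] obtained from [v] by zeroing the coordinates of
    [Iplus] is nonzero.

    A symmetric [D] that is diagonal with respect to [Iplus] does not couple
    [Iplus] and [Iminus], so the inner product of the reduced vectors of [v] and
    [D *m v] is the full quadratic form [u^T *m D *m u] ([subvec_quadratic_form]).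
    Positive definiteness makes this nonnegative, and positive if and only if
    [u] is nonzero. *)

(** The vector is kept in full dimension, rather than passed to the type of
    subvectors, so that positive definiteness of the whole matrix applies to
    it. *)
Definition zero_outside (R : realType) (n : nat) (A : {set 'I_n})
    (v : 'cV[R]_n) : 'cV[R]_n :=
  \col_i (if i \in A then v i 0 else 0).

Lemma zero_outside_eq0 (R : realType) (n : nat) (A : {set 'I_n})
    (v : 'cV[R]_n) :
  zero_outside A v = 0 <-> (forall i, i \in A -> v i 0 = 0).
Proof.
split=> [/matrixP v0 i iA|v0]; first by have := v0 i 0; rewrite !mxE iA.
by apply/matrixP => i j; rewrite !mxE; case: ifP => // /v0.
Qed.

Lemma subvecD (R : realType) (n : nat) (A : {set 'I_n}) (u v : 'cV[R]_n) :
  subvec A u + subvec A v = subvec A (u + v).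
Proof. by apply/matrixP => i j; rewrite !mxE. Qed.

Lemma subvec_dot (R : realType) (n : nat) (A : {set 'I_n}) (u v : 'cV[R]_n) :
  ((subvec A u)^T *m subvec A v) 0 0 = \sum_(i in A) u i 0 * v i 0.
Proof.
by rewrite mxE [RHS]big_enum_val; apply: eq_bigr => k _; rewrite !mxE.
Qed.

(** Symmetry turns the vanishing of the off-diagonal entries in the rows of [A]
    into their vanishing in the columns of [A]; the rows of [D] outside [A]
    therefore only see the coordinates of [v] outside [A]. *)
Lemma subvec_quadratic_form (R : realType) (n : nat) (A : {set 'I_n})
    (D : 'M[R]_n) (v : 'cV[R]_n) :
  D^T = D -> diag_wrt A D ->
  ((subvec (~: A) v)^T *m subvec (~: A) (D *m v)) 0 0 =
  ((zero_outside (~: A) v)^T *m D *m zero_outside (~: A) v) 0 0.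
Proof.
move=> symD diagD; rewrite subvec_dot -mulmxA [RHS]mxE big_mkcond /=.
apply: eq_bigr => i _; rewrite !mxE.
case: ifPn => [iA|_]; last by rewrite mul0r.
congr (_ * _); apply: eq_bigr => j _; rewrite !mxE.
case: ifPn => //; rewrite inE negbK => jA.
have ij : i != j by apply: contraTneq iA => ->; rewrite inE jA.
by rewrite -symD mxE (diagD j i jA ij) !mul0r.
Qed.

Lemma posdef_ge0 (R : realType) (n : nat) (D : 'M[R]_n) (u : 'cV[R]_n) :
  sym_posdef D -> 0 <= (u^T *m D *m u) 0 0.
Proof.
move=> [_ posD]; have [->|/posD/ltW//] := eqVneq u 0.
by rewrite mulmx0 mxE.
Qed.

Lemma posdef_gt0 (R : realType) (n : nat) (D : 'M[R]_n) (u : 'cV[R]_n) :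
  sym_posdef D -> (0 < (u^T *m D *m u) 0 0) = (u != 0).
Proof.
move=> [_ posD]; have [->|/posD//] := eqVneq u 0.
by rewrite mulmx0 mxE ltxx.
Qed.

(** At a zero coordinate outside [Iplus], [g i] is at least [gamma] in absolute
    value and [omega] has the opposite sign, so [g i + omega i] vanishes exactly
    when [g i] is an endpoint of the interval from [- gamma] to [gamma], which is
    all that the first-order condition still permits. *)
Lemma first_order_conditionsE (R : realType) (n : nat) (f : 'cV[R]_n -> R)
    (gamma : R) (x : 'cV[R]_n) :
  0 < gamma ->
  let g := gradient f x in
  first_order_conditions f gamma x <->
  (forall i, i \in Iminus gamma x g -> (g + omega gamma x g) i 0 = 0).
Proof.
move=> gamma0 g; rewrite /first_order_conditions -/g; move: g => g.
have gNN : - gamma < gamma by rewrite gtrN.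
suff foc i : [/\ 0 < x i 0 -> g i 0 = - gamma,
                 x i 0 = 0 -> - gamma <= g i 0 <= gamma
               & x i 0 < 0 -> g i 0 = gamma] <->
             (i \in Iminus gamma x g -> (g + omega gamma x g) i 0 = 0).
  by split=> h i; apply/foc/h.
rewrite !mxE !inE; move: (g i 0) (x i 0) => a y.
have [y0|y0|->] := ltgtP y 0 => /=.
- by split=> [[_ _ ->]//|h]; [rewrite subrr | split=> // _; lra].
- by split=> [[->]//|h]; [rewrite addNr | split=> // _; lra].
rewrite ltr_norml.
have [aN|aN] := leP a (- gamma).
  split=> [[_ /(_ erefl) /andP[? _] _] _|h]; first lra.
  by split=> // _; have {h} := h isT; lra.
have [aP|aP] := leP gamma a; last by split=> // _; split=> // _; rewrite !ltW.
split=> [[_ /(_ erefl) /andP[_ ?] _] _|h]; first lra.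
by split=> // _; have {h} := h isT; lra.
Qed.

Theorem theorem6 (R : realType) (n : nat) (f : 'cV[R]_n -> R) (gamma : R)
    (hgamma : 0 < gamma) (hf : lipschitz_C1 f) (hfb : has_lbound (range f))
    (x : 'cV[R]_n) (sigma : R) (hsigma : 0 < sigma < 1) (D : 'M[R]_n)
    (hD : sym_posdef D)
    (hDI : diag_wrt (Iplus gamma x (gradient f x)) D) :
  let g := gradient f x in
  let w := omega gamma x g in
  let p := D *m (g + w) in
  let I := Iminus gamma x g in
  let q (alpha : R) :=
    sigma * alpha * ((subvec I g + subvec I w)^T *m subvec I p) 0 0 in
  (forall alpha : R, 0 < alpha -> 0 <= q alpha) /\
  ((forall alpha : R, 0 < alpha -> 0 < q alpha) <->
   ~ first_order_conditions f gamma x).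
Proof.
move=> g w p I q.
set u := zero_outside I (g + w).
have qE alpha : q alpha = sigma * alpha * (u^T *m D *m u) 0 0.
  by rewrite /q subvecD subvec_quadratic_form //; case: hD.
have sigma0 : 0 < sigma by case/andP: hsigma.
have focE : first_order_conditions f gamma x <-> u = 0.
  rewrite zero_outside_eq0; exact: first_order_conditionsE.
split=> [alpha alpha0|].
  by rewrite qE mulr_ge0 ?posdef_ge0 // mulr_ge0 // ltW.
rewrite focE; split=> [/(_ 1 ltr01)|/eqP u0 alpha alpha0]; rewrite qE.
  by rewrite mulr1 pmulr_rgt0 // posdef_gt0 // => /eqP.
by rewrite mulr_gt0 ?posdef_gt0 // mulr_gt0.
Qed.
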